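(* For any $w\in F$ and any $r,s\in\mathbb{R}$, the maximum $R(w,r,s)$ is achieved on some representation: there is a homomorphism $\rho:F\to\mathrm{Homeo}^+(S^1)^\sim$ with $\mathrm{rot}^\sim(\rho(a))=r$, $\mathrm{rot}^\sim(\rho(b))=s$ and $\mathrm{rot}^\sim(\rho(w))=R(w,r,s)$.
   Context: $F$ is the free group on two generators $a,b$. $\mathrm{Homeo}^+(S^1)^\sim$ denotes the group of increasing homeomorphisms of $\mathbb{R}$ commuting with $x\mapsto x+1$ (lifts of orientation-preserving homeomorphisms of $S^1=\mathbb{R}/\mathbb{Z}$), and $\mathrm{rot}^\sim(\varphi)=\lim_{n\to\infty}(\varphi^n(x)-x)/n\in\mathbb{R}$ is the real-valued Poincaré rotation number. For $w\in F$ and $r,s\in\mathbb{R}$, $R(w,r,s)$ denotes the supremum of $\mathrm{rot}^\sim(\rho(w))$ over all homomorphisms $\rho:F\to \mathrm{Homeo}^+(S^1)^\sim$ with $\mathrm{rot}^\sim(\rho(a))=r$ and $\mathrm{rot}^\sim(\rho(b))=s$. *)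

(* Defs.v *)
From HB Require Import structures.
From mathcomp Require Import all_boot all_order all_algebra.
From mathcomp Require Import all_classical all_reals all_analysis.
From mathcomp Require Import ring lra.

Set Implicit Arguments.
Unset Strict Implicit.
Unset Printing Implicit Defensive.

Import Order.TTheory GRing.Theory Num.Theory.
Import numFieldNormedType.Exports.

Section FreeGroup.
Variable A : choiceType.

(* The letter (x, false) stands for the generator x, (x, true) for x^-1. *)
Definition letter := (A * bool)%type.

Definition inv_letter (l : letter) : letter := (l.1, ~~ l.2).

Definition reduced (w : seq letter) : bool :=
  sorted (fun l m => m != inv_letter l) w.

Record free_group := FreeGroup { word :> seq letter; _ : reduced word }.

HB.instance Definition _ := [isSub for word].
HB.instance Definition _ := [Choice of free_group by <:].

Definition push (l : letter) (w : seq letter) : seq letter :=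
  if w is m :: w' then if m == inv_letter l then w' else l :: w else [:: l].

Definition word_mul (u v : seq letter) : seq letter := foldr push v u.

Definition word_inv (w : seq letter) : seq letter := rev (map inv_letter w).

Lemma inv_letterK : involutive inv_letter.
Proof. by case=> x e; rewrite /inv_letter /= negbK. Qed.

Lemma push_reduced l w : reduced w -> reduced (push l w).
Proof.
case: w => [//|m w] /= Hw; case: ifPn => [_|ne]; first exact: path_sorted Hw.
by rewrite /= ne.
Qed.

Lemma word_mul_reduced u v : reduced v -> reduced (word_mul u v).
Proof. by move=> Hv; elim: u => //= l u /push_reduced. Qed.

Lemma push_cons l w : reduced (l :: w) -> push l w = l :: w.
Proof. by case: w => //= m w /andP[/negPf ->]. Qed.

Lemma pushK l w : reduced w -> push l (push (inv_letter l) w) = w.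
Proof.
case: w => [|m w] Hw; first by rewrite /= eqxx.
rewrite {2}/push inv_letterK; case: eqP => [eml|_]; last by rewrite /= eqxx.
by rewrite push_cons -eml.
Qed.

Lemma word_mul_push l u v :
  reduced v -> word_mul (push l u) v = push l (word_mul u v).
Proof.
case: u => [//|m u] Hv; rewrite {1}/push; case: eqP => [->|//].
by rewrite [in RHS]/word_mul /= pushK //; apply: word_mul_reduced.
Qed.

Lemma word_mulA u v w :
  reduced w -> word_mul u (word_mul v w) = word_mul (word_mul u v) w.
Proof.
by move=> Hw; elim: u => //= l u IHu; rewrite word_mul_push // -IHu.
Qed.

Lemma word_mulw0 u : reduced u -> word_mul u [::] = u.
Proof.
elim: u => //= l u IHu Hu.
by rewrite IHu ?push_cons //; apply: path_sorted Hu.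
Qed.

Lemma word_mulVw u : word_mul (word_inv u) u = [::].
Proof.
elim: u => //= l u IHu.
rewrite /word_inv /= rev_cons /word_mul foldr_rcons /=.
by rewrite inv_letterK eqxx.
Qed.

Lemma word_invK : involutive word_inv.
Proof. by move=> u; rewrite /word_inv map_rev revK mapK //; apply: inv_letterK. Qed.

Lemma word_inv_reduced u : reduced u -> reduced (word_inv u).
Proof.
rewrite /reduced /word_inv rev_sorted sorted_map.
apply: sub_sorted => l m /=; apply: contra => /eqP.
by move/(can_inj inv_letterK)=> ->; rewrite inv_letterK.
Qed.

Definition fg_one : free_group := @FreeGroup [::] isT.
Definition fg_mul (u v : free_group) : free_group :=
  FreeGroup (word_mul_reduced u (valP v)).
Definition fg_inv (u : free_group) : free_group :=
  FreeGroup (word_inv_reduced (valP u)).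
Definition fg_gen (x : A) : free_group := @FreeGroup [:: (x, false)] isT.

Lemma fg_mulA : associative fg_mul.
Proof. by move=> u v w; apply/val_inj/word_mulA/valP. Qed.
Lemma fg_mul1 : left_id fg_one fg_mul.
Proof. by move=> u; apply/val_inj. Qed.
Lemma fg_mulr1 : right_id fg_one fg_mul.
Proof. by move=> u; apply/val_inj/word_mulw0/valP. Qed.
Lemma fg_mulV : left_inverse fg_one fg_inv fg_mul.
Proof. by move=> u; apply/val_inj/word_mulVw. Qed.
Lemma fg_mulrV : right_inverse fg_one fg_inv fg_mul.
Proof.
move=> u; apply: val_inj => /=.
by rewrite -{1}(word_invK u) word_mulVw.
Qed.

HB.instance Definition _ :=
  isGroup.Build free_group fg_mulA fg_mul1 fg_mulr1 fg_mulV fg_mulrV.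

(* fg_evalM, fg_eval_gen and fg_eval_unique are the universal property of the
   free group. *)
Section Universal.
Local Open Scope group_scope.
Variables (G : groupType) (f : A -> G).

Definition letter_eval (l : letter) : G := if l.2 then (f l.1)^-1 else f l.1.

Definition fg_eval (u : free_group) : G := \prod_(l <- u) letter_eval l.

Lemma fg_evalM : {morph fg_eval : u v / u * v >-> u * v}.
Proof.
move=> u v; rewrite /fg_eval /=; elim: (word u) => [|l w IHw] /=.
  by rewrite big_nil mul1g.
rewrite big_cons -mulgA -IHw; case: (word_mul w v) => [|m w'] /=.
  by rewrite big_seq1 big_nil mulg1.
case: eqP => [->|_]; rewrite ?big_cons // mulgA.
by case: l => x []; rewrite /letter_eval /= ?mulVg ?mulgV mul1g.
Qed.

HB.instance Definition _ := isMultiplicative.Build free_group G fg_eval fg_evalM.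

Lemma fg_eval_gen x : fg_eval (fg_gen x) = f x.
Proof. by rewrite /fg_eval big_seq1. Qed.

Lemma fg_eval_unique (h : {multiplicative free_group -> G}) :
  (forall x, h (fg_gen x) = f x) -> h =1 fg_eval.
Proof.
move=> Hh [w Hw]; rewrite /fg_eval /=.
have h1 : h 1 = 1 by apply: (@mulgI _ (h 1)); rewrite -gmulfM !mulg1.
elim: w Hw => [|[x e] w IHw] Hw.
  by rewrite big_nil -[RHS]h1; congr (h _); apply: val_inj.
have Hw' : reduced w by apply: path_sorted Hw.
have hV y : h (fg_gen y)^-1 = (f y)^-1.
  by apply: (@mulgI _ (f y)); rewrite -{1}Hh -gmulfM !mulgV.
have -> : FreeGroup Hw = (if e then (fg_gen x)^-1 else fg_gen x) * FreeGroup Hw'.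
  by apply: val_inj; case: e Hw => Hw /=; rewrite -[LHS](push_cons Hw).
by rewrite gmulfM big_cons IHw; case: e {Hw} => /=; rewrite ?hV ?Hh.
Qed.

End Universal.

End FreeGroup.

(* The free group on two generators; the alphabet is bool, with a and b the
   generators labelled false and true. *)
Notation F2 := (free_group bool).
Definition gen_a : F2 := fg_gen false.
Definition gen_b : F2 := fg_gen true.

Local Open Scope classical_set_scope.
Local Open Scope ring_scope.

Section HomeoLift.
Variable R : realType.

(* The lifts to R of the orientation-preserving homeomorphisms of R / Z. *)
Definition is_homeo_lift (f : R -> R) : Prop :=
  [/\ {homo f : x y / x < y},
      continuous f,
      exists2 g : R -> R, continuous g & cancel f g /\ cancel g f &
      forall x, f (x + 1) = f x + 1].

Record homeo_lift := HomeoLift {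
  lift_fun :> R -> R;
  homeo_liftP : is_homeo_lift lift_fun }.

HB.instance Definition _ := gen_eqMixin homeo_lift.
HB.instance Definition _ := gen_choiceMixin homeo_lift.

Lemma homeo_lift_ext (f g : homeo_lift) : f =1 g -> f = g.
Proof.
case: f g => f Hf [g Hg] /= /funext efg.
by rewrite efg in Hf *; congr HomeoLift; apply: Prop_irrelevance.
Qed.

Lemma id_homeo_lift : is_homeo_lift id.
Proof.
split=> //; first by move=> x; apply: cvg_id.
by exists id => // x; apply: cvg_id.
Qed.

Lemma comp_homeo_lift (f g : homeo_lift) : is_homeo_lift (f \o g).
Proof.
case: f g => [f [fi fc [f' f'c [fK f'K]] f1]] [g [gi gc [g' g'c [gK g'K]] g1]] /=.
split.
- by move=> x y xy /=; apply/fi/gi.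
- by move=> x; apply: continuous_comp; [apply: gc|apply: fc].
- exists (g' \o f'); first by move=> x; apply: continuous_comp; [apply: f'c|apply: g'c].
  by split; apply: can_comp.
- by move=> x /=; rewrite g1 f1.
Qed.

Lemma inv_homeo_lift (f : homeo_lift) :
  { g : homeo_lift | cancel f g /\ cancel g f }.
Proof.
apply: cid; case: f => f [fi fc [g gc [fK gK]] f1] /=.
suff Hg : is_homeo_lift g by exists (HomeoLift Hg).
split=> //; last by move=> x; apply: (can_inj fK); rewrite f1 !gK.
- move=> x y xy; rewrite ltNge; apply: contraTN xy.
  by rewrite le_eqVlt -leNgt => /predU1P[/(can_inj gK) ->//|/fi/ltW]; rewrite !gK.
- by exists f.
Qed.

Definition lift_one : homeo_lift := HomeoLift id_homeo_lift.
Definition lift_mul (f g : homeo_lift) : homeo_lift :=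
  HomeoLift (comp_homeo_lift f g).
Definition lift_inv (f : homeo_lift) : homeo_lift := sval (inv_homeo_lift f).

Lemma lift_mulA : associative lift_mul.
Proof. by move=> f g h; apply: homeo_lift_ext. Qed.
Lemma lift_mul1 : left_id lift_one lift_mul.
Proof. by move=> f; apply: homeo_lift_ext. Qed.
Lemma lift_mulr1 : right_id lift_one lift_mul.
Proof. by move=> f; apply: homeo_lift_ext. Qed.
Lemma lift_mulV : left_inverse lift_one lift_inv lift_mul.
Proof.
move=> f; apply: homeo_lift_ext => x.
exact: (proj1 (svalP (inv_homeo_lift f))).
Qed.
Lemma lift_mulrV : right_inverse lift_one lift_inv lift_mul.
Proof.
move=> f; apply: homeo_lift_ext => x.
exact: (proj2 (svalP (inv_homeo_lift f))).
Qed.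

HB.instance Definition _ :=
  isGroup.Build homeo_lift lift_mulA lift_mul1 lift_mulr1 lift_mulV lift_mulrV.

(* The base point 0 is immaterial, see rotnum_cvg. *)
Definition rotnum (f : homeo_lift) : R :=
  limn (fun n => ((f ^+ n)%g 0 - 0) / n%:R).

Lemma lift_mono (f : homeo_lift) x y : x <= y -> f x <= f y.
Proof. by case: f => f [fi _ _ _] /=; apply: ltW_homo. Qed.

Lemma lift_addz (f : homeo_lift) x (m : int) : f (x + m%:~R) = f x + m%:~R.
Proof.
have addn y (n : nat) : f (y + n%:R) = f y + n%:R.
  elim: n => [|n IHn]; first by rewrite !addr0.
  by case: f IHn => f [_ _ _ f1] /= IHn; rewrite -natr1 !addrA f1 IHn.
case: m => n; first exact: addn.
by rewrite NegzE mulrNz; apply: (addIr n.+1%:R); rewrite -addn !subrK.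
Qed.

Lemma lift_disp (f : homeo_lift) x y : `|(f x - x) - (f y - y)| <= 1.
Proof.
pose m := Num.floor (x - y).
have [lo hi] : m%:~R <= x - y /\ x - y < m%:~R + 1.
  split; first exact: floor_le.
  by have := floorD1_gt (x - y); rewrite intrD.
have l1 : f (y + m%:~R) <= f x by apply: lift_mono; lra.
have l2 : f x <= f (y + (m + 1)%:~R) by apply: lift_mono; rewrite intrD; lra.
move: l1 l2; rewrite !lift_addz intrD => l1 l2.
by rewrite ler_norml; apply/andP; split; lra.
Qed.

Lemma lift_disp_expn (f : homeo_lift) n x :
  `|((f ^+ n)%g x - x) - n%:R * (f x - x)| <= n%:R.
Proof.
elim: n => [|n IHn]; first by rewrite expg0 /= mul0r !subrr normr0.
have -> : (f ^+ n.+1)%g x = f ((f ^+ n)%g x) by rewrite expgS.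
have := lift_disp f ((f ^+ n)%g x) x; move: IHn.
rewrite !ler_norml -natr1 => /andP[? ?] /andP[? ?].
by apply/andP; split; lra.
Qed.

Lemma rotnum_cauchy (f : homeo_lift) x m n :
  `|((f ^+ m.+1)%g x - x) / m.+1%:R - ((f ^+ n.+1)%g x - x) / n.+1%:R|
    <= m.+1%:R^-1 + n.+1%:R^-1 :> R.
Proof.
have H k l : `|((f ^+ (k.+1 * l.+1)%N)%g x - x) / (k.+1 * l.+1)%N%:R
               - ((f ^+ k.+1)%g x - x) / k.+1%:R| <= k.+1%:R^-1 :> R.
  have := lift_disp_expn (f ^+ k.+1)%g l.+1 x; rewrite -expgnA.
  set A := _ x - x; set B := _ x - x => H.
  have -> : A / (k.+1 * l.+1)%N%:R - B / k.+1%:R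
            = (A - l.+1%:R * B) / (k.+1%:R * l.+1%:R).
    by rewrite natrM; field; rewrite !nat1r !pnatr_eq0.
  rewrite normrM normfV (ger0_norm (x := _ * _)) ?mulr_ge0 // ler_pdivrMr ?mulr_gt0 //.
  by rewrite mulrA mulVf ?pnatr_eq0 // mul1r.
have := H n m; rewrite mulnC => Hn.
by apply: le_trans (ler_distD _ _ _) (lerD _ Hn); rewrite distrC; apply: H.
Qed.

Lemma rotnum_cvg (f : homeo_lift) (x : R) :
  (fun n => ((f ^+ n)%g x - x) / n%:R) @ \oo --> rotnum f.
Proof.
have cvg0 : cvgn (fun n => ((f ^+ n)%g 0 - 0) / n%:R : R).
  apply/cauchy_cvgP/cauchy_exP => e e0.
  have e20 : 0 < e / 2 by rewrite divr_gt0.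
  have [N _ HN] := cvgr0_norm_lt _ (@cvg_harmonic R) _ e20.
  exists (((f ^+ N.+1)%g 0 - 0) / N.+1%:R); exists N.+1 => // -[//|n] /= Nn.
  apply: le_lt_trans (rotnum_cauchy f 0 N n) _.
  have h k : (N <= k)%N -> k.+1%:R^-1 < e / 2.
    by move=> /HN /=; rewrite ger0_norm // invr_ge0.
  by rewrite [e]splitr ltrD // h.
have close : (fun n => ((f ^+ n)%g x - x) / n%:R
                       - ((f ^+ n)%g 0 - 0) / n%:R : R) @ \oo --> (0 : R).
  rewrite -(cvg_shiftS _) /=; apply: norm_cvg0.
  apply: (squeeze_cvgr _ (cvg_cst 0) (@cvg_harmonic R)).
  near=> n; rewrite normr_ge0 /= -mulrBl normrM [X in _ * X]ger0_norm ?invr_ge0 //.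
  by rewrite ler_piMl ?invr_ge0 //; apply: lift_disp.
pose v n : R := ((f ^+ n)%g x - x) / n%:R.
pose u n : R := ((f ^+ n)%g 0 - 0) / n%:R.
have E : v = (v - u) + u by apply/funext => n; rewrite /= !fctE subrK.
change (v @ \oo --> rotnum f); rewrite -[rotnum f]add0r E.
exact: cvgD close cvg0.
Unshelve. all: by end_near. Qed.

End HomeoLift.

(* The supremum R(w, r, s), taken in \bar R because the real-valued sup is 0 on
   sets that are empty or unbounded above. *)
Definition max_rot (R : realType) (w : F2) (r s : R) : \bar R :=
  ereal_sup [set (rotnum (rho w))%:E | rho in
    [set rho : {multiplicative F2 -> homeo_lift R} |
      rotnum (rho gen_a) = r /\ rotnum (rho gen_b) = s]].

(* Main.v *)
(* A finitely generated group of homeomorphisms of the circle can be conjugated,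
   without changing rotation numbers, so that each generator is Lipschitz with a
   constant depending only on the number of generators, up to an arbitrarily
   small additive error.  Along a sequence of representations whose values
   rot(w) tend to R(w, r, s), conjugated with errors tending to 0, the pointwise
   ultralimit of each generator and of its inverse is therefore Lipschitz, and
   the limits define a representation.  Since |f^n(0) - n rot(f)| <= 1 for every
   lift f, rotation numbers are continuous under this convergence. *)
Require Import Defs.
From mathcomp Require Import all_boot all_order all_algebra.
From mathcomp Require Import all_classical all_reals all_analysis.
From mathcomp Require Import ring lra.

Set Implicit Arguments.
Unset Strict Implicit.
Unset Printing Implicit Defensive.

Import Order.TTheory GRing.Theory Num.Theory.
Import numFieldNormedType.Exports.

Section Representations.
Local Open Scope classical_set_scope.
Local Open Scope ring_scope.

Variable R : realType.
Implicit Types (f g h : homeo_lift R) (x y : R).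

(** * Lifts of circle homeomorphisms *)

Lemma homeo_lift_mulE f g x : (f * g)%g x = f (g x).
Proof. by []. Qed.

Lemma homeo_liftK f : cancel f (f^-1)%g.
Proof. exact: (proj1 (svalP (inv_homeo_lift f))). Qed.

Lemma homeo_liftVK f : cancel (f^-1)%g f.
Proof. exact: (proj2 (svalP (inv_homeo_lift f))). Qed.

Lemma homeo_lift1 f x : f (x + 1) = f x + 1.
Proof. by case: f => f []. Qed.

Lemma homeo_lift_continuous f : continuous f.
Proof. by case: f => f []. Qed.

(** Since [F] sends [n] and [- n] to [F 0 + n] and [F 0 - n], every value is bracketed and the
    intermediate value theorem gives surjectivity. *)
Lemma is_homeo_lift_increasing (F : R -> R) :
  {homo F : x y / x < y} -> continuous F -> (forall x, F (x + 1) = F x + 1) ->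
  is_homeo_lift F.
Proof.
move=> Finc Fc F1.
have Fn n x : F (x + n%:R) = F x + n%:R.
  by elim: n => [|n IHn]; rewrite ?addr0 // -natr1 !addrA F1 IHn.
have Finj : injective F.
  move=> x y; case: (ltgtP x y) => // /Finc; last by move=> + e; rewrite e ltxx.
  by move=> + e; rewrite e ltxx.
have Fsurj v : exists x, F x = v.
  pose n := Num.bound `|v - F 0|.
  have := archi_boundP (normr_ge0 (v - F 0)); rewrite -/n ltr_norml => /andP[lo hi].
  have F0 : F (- n%:R) = F 0 - n%:R by rewrite -[in F 0](addNr n%:R) Fn addrK.
  have Fp : F n%:R = F 0 + n%:R by rewrite -[X in F X]add0r Fn.
  have n0 : (0 : R) <= n%:R by [].
  have le : - n%:R <= n%:R :> R by lra.
  have [||c _ <-] := @IVT R F _ _ v le.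
  - exact: continuous_subspaceT.
  - rewrite F0 Fp min_l ?max_r; last 2 first; try lra.
  - by exists c.
have [G FG] := choice Fsurj.
have GF : cancel F G by move=> x; apply: Finj.
split=> //; exists G => // y; rewrite -(FG y).
apply: (@nbhs_singleton _ (F (G y)) (fun z => {for z, continuous G})).
by apply: (@near_can_continuous R F G (G y)); near=> z; [exact: GF|exact: Fc].
Unshelve. all: by end_near. Qed.

Lemma is_homeo_lift_translation (t : R) : is_homeo_lift (fun x => x + t).
Proof.
apply: is_homeo_lift_increasing => [x y|x|x]; first by rewrite ltrD2r.
- by apply: cvgD; [exact: cvg_id|exact: cvg_cst].
- by rewrite addrAC.
Qed.

Definition translation (t : R) : homeo_lift R :=
  HomeoLift (is_homeo_lift_translation t).

(** * Rotation numbers: uniform estimate, conjugacy invariance, continuity *)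

Lemma rotnum_dist f n x : `|(f ^+ n)%g x - x - n%:R * rotnum f| <= 1.
Proof.
case: n => [|n]; first by rewrite expg0 mul0r subr0 /= subrr normr0.
have n0 : 0 < n.+1%:R :> R by [].
suff H : `|((f ^+ n.+1)%g x - x) / n.+1%:R - rotnum f| <= n.+1%:R^-1.
  have -> : (f ^+ n.+1)%g x - x - n.+1%:R * rotnum f =
            n.+1%:R * (((f ^+ n.+1)%g x - x) / n.+1%:R - rotnum f).
    by rewrite mulrBr mulrCA mulfV ?mulr1 // gt_eqF.
  by rewrite normrM gtr0_norm // -ler_pdivlMl // mulr1.
have := @rotnum_cvg R f x; rewrite -(cvg_shiftS _) => cv.
have cvl : (fun m => `|((f ^+ n.+1)%g x - x) / n.+1%:R -
                       ((f ^+ m.+1)%g x - x) / m.+1%:R|) @ \oo -->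
           `|((f ^+ n.+1)%g x - x) / n.+1%:R - rotnum f|.
  by apply: cvg_norm; apply: cvgB; [exact: cvg_cst|exact: cv].
have cvr : (fun m => n.+1%:R^-1 + m.+1%:R^-1 : R) @ \oo --> (n.+1%:R^-1 + 0 : R).
  by apply: cvgD; [exact: cvg_cst|exact: cvg_harmonic].
rewrite -[leRHS]addr0; apply: (ler_cvg_to cvl cvr); apply: nearW => m.
exact: rotnum_cauchy.
Qed.

Lemma rotnum_unique f (c K : R) :
  (forall n, `|(f ^+ n)%g 0 - n%:R * c| <= K) -> rotnum f = c.
Proof.
move=> H; apply/eqP; rewrite -subr_eq0 -normr_le0.
apply/ler_addgt0Pr => e e0; rewrite add0r.
pose n := (Num.bound `|(K + 1) / e|).+1.
have n0 : 0 < n%:R :> R by [].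
have hn : (K + 1) / e < n%:R.
  apply: le_lt_trans (ler_norm _) _.
  by apply: lt_trans (archi_boundP (normr_ge0 _)) _; rewrite ltr_nat.
have : `|n%:R * (rotnum f - c)| <= K + 1.
  have := H n; have := rotnum_dist f n 0; rewrite !subr0 mulrBr !ler_norml.
  by move=> /andP[? ?] /andP[? ?]; apply/andP; split; lra.
rewrite normrM gtr0_norm // => h; rewrite -(ler_pM2l n0); apply: le_trans h _.
by move: hn; rewrite ltr_pdivrMr // => /ltW.
Qed.

Lemma rotnum_translation t : rotnum (translation t) = t.
Proof.
apply: (@rotnum_unique _ _ 0) => n.
suff -> : (translation t ^+ n)%g 0 = n%:R * t by rewrite subrr normr0.
elim: n => [|n IHn]; first by rewrite expg0 mul0r.
by rewrite expgS homeo_lift_mulE IHn /= -natr1 mulrDl mul1r.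
Qed.

Lemma rotnum_conj f h : rotnum (f ^ h)%g = rotnum f.
Proof.
apply: (@rotnum_unique _ _ (`|h 0| + `|(h^-1)%g 0| + 2)) => n.
rewrite -conjXg /conjg !homeo_lift_mulE.
have := rotnum_dist f n (h 0); set z := (f ^+ n)%g _.
have := lift_disp (h^-1)%g z 0; have := ler_norm (h 0).
have := ler_norm (- h 0); have := ler_norm ((h^-1)%g 0).
have := ler_norm (- (h^-1)%g 0); rewrite !normrN !ler_norml.
by move=> ? ? ? ? /andP[? ?] /andP[? ?]; apply/andP; split; lra.
Qed.

(** The [n]-th iterate of 0 determines the rotation number up to an error 1/n, so convergence of
    each iterate suffices, without uniformity in [n]. *)
Lemma rotnum_limit (T : Type) (U : set_system T) {UF : ProperFilter U}
    (f : T -> homeo_lift R) g :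
  (forall n, (f k ^+ n)%g 0 @[k --> U] --> (g ^+ n)%g 0) ->
  rotnum (f k) @[k --> U] --> rotnum g.
Proof.
move=> H; apply/cvgrPdist_le => e e0.
(* The 3 adds one unit from [rotnum_dist] for [g], one for [f k], and one for the distance between
   their [n]-th iterates of 0. *)
pose n := (Num.bound `|3 / e|).+1.
have n0 : 0 < n%:R :> R by [].
have hn : 3 / e < n%:R.
  apply: le_lt_trans (ler_norm _) _.
  by apply: lt_trans (archi_boundP (normr_ge0 _)) _; rewrite ltr_nat.
have /cvgrPdist_le /(_ 1 ltr01) := H n; apply: filterS => k hk.
have : `|n%:R * (rotnum g - rotnum (f k))| <= 3.
  have := rotnum_dist g n 0; have := rotnum_dist (f k) n 0; move: hk.
  rewrite !subr0 mulrBr !ler_norml.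
  by move=> /andP[? ?] /andP[? ?] /andP[? ?]; apply/andP; split; lra.
rewrite normrM gtr0_norm // => h; rewrite -(ler_pM2l n0); apply: le_trans h _.
by move: hn; rewrite ltr_pdivrMr // => /ltW.
Qed.

(** * Conjugating finitely many lifts to nearly Lipschitz ones *)

Section Averaging.
Variables (I : finType) (s : I -> homeo_lift R).

Lemma is_homeo_lift_average h :
  is_homeo_lift (fun x => (x + \sum_i h (s i x)) / #|I|.+1%:R).
Proof.
have n0 : 0 < #|I|.+1%:R :> R by [].
apply: is_homeo_lift_increasing => [x y xy|x|x].
- rewrite ltr_pM2r ?invr_gt0 //; apply: ltr_leD => //.
  by apply: ler_sum => i _; do 2 apply: lift_mono; exact: ltW.
- apply: cvgM; last exact: cvg_cst.
  apply: cvgD; first exact: cvg_id.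
  apply: cvg_big => [|i _]; first exact: add_continuous.
  by apply: (continuous_comp (@homeo_lift_continuous (s i) x)); exact: homeo_lift_continuous.
- under eq_bigr do rewrite !homeo_lift1.
  rewrite big_split /= sumr_const -[in X in _ + (_ + X)]/(#|I|%:R).
  by rewrite -natr1; field; rewrite natr1 gt_eqF.
Qed.

Definition average h : homeo_lift R := HomeoLift (is_homeo_lift_average h).

(* The limit of [iter_average n] would conjugate every [s i] to a map with
   Lipschitz constant [#|I| + 1]; stopping at step [n] costs an additive error
   decaying geometrically in [n], and avoids constructing that limit. *)
Definition iter_average n := iter n average 1%g.

(** By monotonicity, the increment of [h] along [s i] is one of several nonnegative terms that sum
    to [#|I|.+1] times the increment of [average h]. *)
Lemma average_bound h i x y :
  `|h (s i x) - h (s i y)| <= #|I|.+1%:R * `|average h x - average h y|.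
Proof.
wlog xy : x y / x <= y.
  move=> H; case: (leP x y) => [/H //|/ltW /H].
  by rewrite distrC [in X in _ * X]distrC.
have n0 : 0 < #|I|.+1%:R :> R by [].
rewrite distrC [in X in _ * X]distrC !ger0_norm ?subr_ge0; last 2 first.
- exact: lift_mono.
- by do 2 apply: lift_mono.
rewrite /= -mulrBl mulrC mulfVK ?gt_eqF //.
rewrite opprD addrACA -sumrB (bigD1 i) //=.
have : 0 <= \sum_(j | j != i) (h (s j y) - h (s j x)).
  by apply: sumr_ge0 => j _; rewrite subr_ge0; do 2 apply: lift_mono.
by move: xy; lra.
Qed.

(** The identity term of [average] cancels between successive iterates, leaving [#|I|] terms divided
    by [#|I|.+1]: each step contracts by that ratio. *)
Lemma iter_average_dist n x y :
  `|(iter_average n.+1 x - iter_average n x) -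
    (iter_average n.+1 y - iter_average n y)| <= (#|I|%:R / #|I|.+1%:R) ^+ n.
Proof.
have n0 : 0 < #|I|.+1%:R :> R by [].
elim: n x y => [|n IHn] x y; first exact: lift_disp.
pose d z := iter_average n.+1 z - iter_average n z.
have E z : iter_average n.+2 z - iter_average n.+1 z =
  (\sum_i d (s i z)) / #|I|.+1%:R.
  rewrite /iter_average iterS (iterS n) [X in X - _]/= [X in _ - X]/= -mulrBl.
  by rewrite opprD addrACA subrr add0r -sumrB.
rewrite !E -mulrBl -sumrB normrM [X in _ * X]gtr0_norm ?invr_gt0 //.
rewrite exprS mulrAC ler_pM2r ?invr_gt0 //.
apply: le_trans (ler_norm_sum _ _ _) _.
apply: le_trans (ler_sum _ (fun i _ => IHn (s i x) (s i y))) _.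
by rewrite sumr_const mulr_natl [leRHS]mulr_natl.
Qed.

Lemma conj_near_lipschitz (e : R) : 0 < e -> exists h, forall i x y,
  `|(s i ^ h)%g x - (s i ^ h)%g y| <= #|I|.+1%:R * `|x - y| + e.
Proof.
move=> e0; have n0 : 0 < #|I|.+1%:R :> R by [].
pose q : R := #|I|%:R / #|I|.+1%:R.
have q1 : `|q| < 1.
  by rewrite ger0_norm ?divr_ge0 // ltr_pdivrMr // mul1r ltr_nat.
have /cvgrPdist_le /(_ (e / #|I|.+1%:R)) := cvg_expr q1.
case=> [|N _ /(_ N (leqnn N))] /=; first by rewrite divr_gt0.
rewrite sub0r normrN => qN.
(* As [f ^ h] is [h^-1 * f * h], the inverse is taken to obtain [h * s i * h^-1] with [h] the
   iterate. The factor [#|I|.+1] of [average_bound] also multiplies the error, whence the choice of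
   [N]. *)
exists (iter_average N)^-1%g => i x y; rewrite /conjg invgK.
set h := iter_average N; set x' := (h^-1)%g x; set y' := (h^-1)%g y.
apply: le_trans (average_bound h i x' y') _.
rewrite -(homeo_liftVK h x) -(homeo_liftVK h y) -/x' -/y'.
rewrite -[in leRHS](mulfVK (x := #|I|.+1%:R) _ e) ?gt_eqF //.
rewrite [e / _ * _]mulrC -mulrDr ler_pM2l //.
have := iter_average_dist N x' y'; rewrite -/q.
rewrite [iter_average N.+1]/(average h) -/h => le1.
have := le_trans (ler_norm _) qN; move: le1.
set A := average h x'; set B := average h y' => le1 le2.
have -> : A - B = (h x' - h y') + (A - h x' - (B - h y')) by ring.
apply: le_trans (ler_normD _ _) _; rewrite lerD2l.
exact: le_trans le1 le2.
Qed.

End Averaging.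

(** * Limits along an ultrafilter *)

Section UltraLimits.
Variable U : set_system nat.
Context {UF : UltraFilter U}.

(** Compactness gives a cluster point, and a cluster point of an ultrafilter is a limit. *)
Lemma ultra_cvg_bounded (u : nat -> R) (m M : R) :
  (forall k, m <= u k <= M) -> exists l : R, u @ U --> l.
Proof.
move=> uM.
have [|l [_ cl]] := @segment_compact R m M (u @ U) _.
  by apply: (@filterE _ U) => k; rewrite /= in_itv /= uM.
exists l => B nB; have [//|UnB] := in_ultra_setVsetC (u @^-1` B) UF.
by have [z [/= nBz Bz]] := cl (~` B) B UnB nB.
Qed.

(** This lets pointwise limits be composed: moving the argument from [u k] to [x] costs at most
    [C * |u k - x| + e k], which tends to 0. *)
Lemma cvg_near_lipschitz (F : nat -> R -> R) (G : R -> R) (C : R) (e u : nat -> R) x :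
  (forall k y z, `|F k y - F k z| <= C * `|y - z| + e k) ->
  e @ U --> (0 : R) -> (forall y, F k y @[k --> U] --> G y) ->
  u @ U --> x -> F k (u k) @[k --> U] --> G x.
Proof.
move=> lipF e0 FG ux.
have -> : (fun k => F k (u k)) = (fun k => F k (u k) - F k x) \+ (F^~ x).
  by apply/funext => k; rewrite /= subrK.
rewrite -[G x]add0r; apply: cvgD; last exact: FG.
have b0 : C * `|u k - x| + e k @[k --> U] --> (0 : R).
  rewrite -[X in _ --> X]addr0 -[X in _ --> X + _](mulr0 C).
  apply: cvgD => //; apply: cvgMr.
  rewrite -(@normr0 _ R) -(subrr x); apply: cvg_norm.
  by apply: cvgB => //; exact: cvg_cst.
apply: norm_cvg0; apply: (squeeze_cvgr _ (cvg_cst 0) b0).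
by apply: nearW => k; rewrite normr_ge0 lipF.
Qed.

Lemma near_lipschitz_limit (F : nat -> R -> R) (G : R -> R) (C : R) (e : nat -> R) :
  (forall k y z, `|F k y - F k z| <= C * `|y - z| + e k) ->
  e @ U --> (0 : R) -> (forall y, F k y @[k --> U] --> G y) ->
  forall x y, `|G x - G y| <= C * `|x - y|.
Proof.
move=> lipF e0 FG x y.
have l : `|F k x - F k y| @[k --> U] --> `|G x - G y|.
  by apply: cvg_norm; apply: cvgB; exact: FG.
have r : C * `|x - y| + e k @[k --> U] --> (C * `|x - y| + 0 : R).
  by apply: cvgD => //; exact: cvg_cst.
rewrite -[leRHS]addr0; apply: (ler_cvg_to l r); apply: nearW => k; exact: lipF.
Qed.

Lemma lipschitz_continuous (G : R -> R) (C : R) :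
  (forall x y, `|G x - G y| <= C * `|x - y|) -> continuous G.
Proof.
move=> lipG x; apply/cvgrPdist_le => e e0.
have C0 : 0 < `|C| + 1 by apply: ltr_wpDl.
near=> y; apply: le_trans (lipG x y) _.
apply: (@le_trans _ _ ((`|C| + 1) * `|x - y|)).
  by apply: ler_wpM2r => //; apply: le_trans (ler_norm C) _; rewrite lerDl.
rewrite -ler_pdivlMl // mulrC; near: y.
have : id y @[y --> x] --> x by exact: cvg_id.
by move/cvgrPdist_le; apply; rewrite divr_gt0.
Unshelve. all: by end_near. Qed.

Lemma homeo_lift_ultralimit (f : nat -> homeo_lift R) (C K : R) (e : nat -> R) :
  e @ U --> (0 : R) -> (forall k x, `|f k x - x| <= K) ->
  (forall k x y, `|f k x - f k y| <= C * `|x - y| + e k) ->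
  (forall k x y, `|(f k)^-1%g x - (f k)^-1%g y| <= C * `|x - y| + e k) ->
  exists F : homeo_lift R, forall x,
    f k x @[k --> U] --> F x /\ (f k)^-1%g x @[k --> U] --> F^-1%g x.
Proof.
move=> e0 fK lip lipV.
have fVK k x : `|(f k)^-1%g x - x| <= K.
  by have := fK k ((f k)^-1%g x); rewrite homeo_liftVK distrC.
have ex (g : nat -> R -> R) : (forall k x, `|g k x - x| <= K) ->
    exists G : R -> R, forall x, g k x @[k --> U] --> G x.
  move=> gK; suff /choice[G GP] : forall x, exists l : R, g k x @[k --> U] --> l by exists G.
  move=> x; apply: (@ultra_cvg_bounded (g^~ x) (x - K) (x + K)) => k.
  by have := gK k x; rewrite ler_distl.
have [G fG] := ex _ fK; have [H fH] := ex _ fVK.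
(* The cancellation identities at stage [k] pass to the limit because composition does. *)
have GK : cancel G H.
  move=> x; have := cvg_near_lipschitz lipV e0 fH (fG x).
  under eq_cvg do rewrite homeo_liftK.
  by move/cvg_unique => /(_ (@norm_hausdorff _ _)); apply; exact: cvg_cst.
have HK : cancel H G.
  move=> x; have := cvg_near_lipschitz lip e0 fG (fH x).
  under eq_cvg do rewrite homeo_liftVK.
  by move/cvg_unique => /(_ (@norm_hausdorff _ _)); apply; exact: cvg_cst.
have Gc := lipschitz_continuous (near_lipschitz_limit lip e0 fG).
have Hc := lipschitz_continuous (near_lipschitz_limit lipV e0 fH).
have homG : is_homeo_lift G.
  split=> // [x y xy||x].
  (* A limit keeps only weak monotonicity; strictness comes from injectivity of [G]. *)
  - rewrite lt_neqAle (can_eq GK) lt_eqF //=.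
    apply: (ler_cvg_to (fG x) (fG y)); apply: nearW => k.
    exact/lift_mono/ltW.
  - by exists H.
  - have := fG (x + 1); under eq_cvg do rewrite homeo_lift1.
    move/cvg_unique => /(_ (@norm_hausdorff _ _)); apply.
    by apply: cvgD; [exact: fG|exact: cvg_cst].
exists (HomeoLift homG) => x; split; first exact: fG.
suff -> : (HomeoLift homG)^-1%g x = H x by exact: fH.
by apply: (can_inj GK); rewrite HK; exact: (homeo_liftVK (HomeoLift homG)).
Qed.

Lemma fg_eval_limit (f : nat -> bool -> homeo_lift R) (F : bool -> homeo_lift R)
    (C : R) (e : nat -> R) :
  e @ U --> (0 : R) ->
  (forall k l x y, `|letter_eval (f k) l x - letter_eval (f k) l y|
                   <= C * `|x - y| + e k) ->
  (forall l x, letter_eval (f k) l x @[k --> U] --> letter_eval F l x) ->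
  forall (u : F2) x, fg_eval (f k) u x @[k --> U] --> fg_eval F u x.
Proof.
move=> e0 lip fF u x; rewrite /fg_eval; elim: (word u) => [|l v IHv].
  by rewrite big_nil; under eq_cvg do rewrite big_nil; exact: cvg_cst.
rewrite big_cons; under eq_cvg do rewrite big_cons.
exact: (cvg_near_lipschitz (fun k => lip k l) e0 (fF l) IHv).
Qed.

(** Powers of the image of [u] are images of powers of [u], so convergence on all words controls
    every iterate. *)
Lemma rotnum_fg_eval_limit (f : nat -> bool -> homeo_lift R) (F : bool -> homeo_lift R) :
  (forall (u : F2) x, fg_eval (f k) u x @[k --> U] --> fg_eval F u x) ->
  forall u, rotnum (fg_eval (f k) u) @[k --> U] --> rotnum (fg_eval F u).
Proof.
move=> fF u; apply: rotnum_limit => n.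
have E (g : bool -> homeo_lift R) : (fg_eval g u ^+ n = fg_eval g (u ^+ n))%g.
  elim: n => [|n IHn]; first by rewrite !expg0 /fg_eval big_nil.
  by rewrite !expgS IHn fg_evalM.
by rewrite E; under eq_cvg do rewrite E; exact: fF.
Qed.

End UltraLimits.

(** * Representations of the free group and the extremal one *)

Lemma rotnum_lift_dist f x : `|f x - x| <= `|rotnum f| + 1.
Proof.
have := rotnum_dist f 1 x; rewrite expg1 mul1r => h.
have -> : f x - x = rotnum f + (f x - x - rotnum f) by ring.
by apply: le_trans (ler_normD _ _) _; rewrite lerD2l.
Qed.

Lemma letter_eval_conj (f : bool -> homeo_lift R) h l :
  letter_eval (fun b => f b ^ h)%g l = (letter_eval f l ^ h)%g.
Proof. by case: l => b []; rewrite /letter_eval //= conjVg. Qed.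

Lemma fg_eval_conj (f : bool -> homeo_lift R) h (u : F2) :
  fg_eval (fun b => f b ^ h)%g u = (fg_eval f u ^ h)%g.
Proof.
rewrite /fg_eval (big_morph (fun g => g ^ h)%g (fun f g => conjMg f g h) (conj1g h)).
by apply: eq_bigr => l _; exact: letter_eval_conj.
Qed.

(** Averaging runs over all four letters, so inverses of generators are controlled too; 5 is 4 +
    1. *)
Lemma fg_eval_near_lipschitz (f : bool -> homeo_lift R) (e : R) : 0 < e ->
  exists h, forall l x y,
    `|letter_eval (fun b => f b ^ h)%g l x - letter_eval (fun b => f b ^ h)%g l y|
      <= 5 * `|x - y| + e.
Proof.
move=> e0.
have [h hP] := conj_near_lipschitz (I := (bool * bool)%type) (letter_eval f) e0.
exists h => l x y; rewrite letter_eval_conj.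
by have := hP l x y; rewrite card_prod card_bool.
Qed.

End Representations.

Theorem lemma2p13 (R : realType) (w : F2) (r s : R) :
  exists rho : {multiplicative F2 -> homeo_lift R},
    [/\ rotnum (rho gen_a) = r, rotnum (rho gen_b) = s &
        (rotnum (rho w))%:E = max_rot w r s].
Proof.
pose S := [set (rotnum (rho w))%:E | rho in
    [set rho : {multiplicative F2 -> homeo_lift R} |
      rotnum (rho gen_a) = r /\ rotnum (rho gen_b) = s]]%classic.
have S0 : S != set0.
  (* Translations by [r] and [s] show that the supremum is over a nonempty set. *)
  apply/set0P; pose f b := translation (if b then s else r).
  exists (rotnum (fg_eval f w))%:E, (fg_eval f : {multiplicative F2 -> homeo_lift R}) => //=.
  by rewrite !fg_eval_gen !rotnum_translation.
have [u Su uS] := ereal_sup_seq S0.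
have {}Su k : exists f : bool -> homeo_lift R, [/\ rotnum (f false) = r,
    rotnum (f true) = s, u k = (rotnum (fg_eval f w))%:E &
    forall l x y, (`|letter_eval f l x - letter_eval f l y| <=
      5 * `|x - y| + k.+1%:R^-1)%R].
  have [rho /= [ra rb] <-] := Su k.
  pose f b := rho (fg_gen b).
  have [|h hP] := @fg_eval_near_lipschitz R f k.+1%:R^-1; first by rewrite invr_gt0.
  (* Conjugating both generators by the same [h] preserves the rotation number of every word. *)
  exists (fun b => f b ^ h)%g; split=> //; rewrite ?rotnum_conj //.
  by rewrite fg_eval_conj rotnum_conj (@fg_eval_unique _ _ f rho).
have [f /all_and4[fa fb fu lip]] := choice Su.
(* [U] refines [\oo], so ordinary limits of sequences persist along it. *)
have [U [UU Uoo]] := @ultraFilterLemma nat \oo%classic _.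
pose K : R := (`|r| + `|s| + 1)%R.
have fK k b x : (`|f k b x - x| <= K)%R.
  apply: le_trans (rotnum_lift_dist _ _) _.
  by case: b; rewrite ?fa ?fb lerD2r ?lerDl ?lerDr.
have e0 : ((k.+1%:R^-1 : R)%R @[k --> U] --> (0%R : R))%classic.
  by apply: cvg_trans (@cvg_harmonic R); apply: cvg_app.
have /choice [F FP] : forall b, exists F : homeo_lift R, forall x,
    (f k b x @[k --> U] --> F x /\ (f k b)^-1%g x @[k --> U] --> F^-1%g x)%classic.
  move=> b; apply: (homeo_lift_ultralimit (C := 5) (K := K) e0) => k x //.
  - exact: (lip k (b, false)).
  - exact: (lip k (b, true)).
have fF (v : F2) x : (fg_eval (f k) v x @[k --> U] --> fg_eval F v x)%classic.
  by apply: (fg_eval_limit e0 lip) => -[b []] z; have [] := FP b z.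
have rF := @rotnum_fg_eval_limit R U UU f F fF.
exists (fg_eval F : {multiplicative F2 -> homeo_lift R}); split.
- have := rF gen_a; under eq_cvg do rewrite fg_eval_gen fa.
  by move/cvg_unique => /(_ (@norm_hausdorff _ _)); apply; exact: cvg_cst.
- have := rF gen_b; under eq_cvg do rewrite fg_eval_gen fb.
  by move/cvg_unique => /(_ (@norm_hausdorff _ _)); apply; exact: cvg_cst.
(* Along [U], [u] tends both to this real number and to the supremum, so the supremum is finite and
   attained. *)
- have uF : (u @ U --> (rotnum (fg_eval F w))%:E)%classic.
    under eq_cvg do rewrite fu.
    by apply: cvg_EFin; [exact: nearW|exact: rF].
  apply: (cvg_unique _ uF); first exact: ereal_hausdorff.
  by apply: cvg_trans uS; apply: cvg_app.
Qed.
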